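(* Let $\mathcal P$ be a good grid of a finite measure space $(I,\mathbb A,m)$ and $0<s<1$. Then $$M(\mathcal B^s_{1,1})=\mathcal B^s_{1,1,selfs}.$$
   Context: $|J|=m(J)$; $\mathbb N=\{0,1,\dots\}$. Good grid: for some $0<\lambda_1<\lambda_2<1$, a sequence $\mathcal P=(\mathcal P^k)_{k\in\mathbb N}$ of finite families of measurable sets of positive measure with: $\mathcal P^0=\{I\}$; $I=\bigcup_{Q\in\mathcal P^k}Q$ up to a null set; the elements of $\mathcal P^k$ are pairwise disjoint; every $Q\in\mathcal P^k$, $k>0$, is contained in some $P\in\mathcal P^{k-1}$; $\lambda_1\le|Q|/|P|\le\lambda_2$ whenever $Q\subset P$, $Q\in\mathcal P^{k+1}$, $P\in\mathcal P^k$; $\bigcup_k\mathcal P^k$ generates $\mathbb A$. An $(s,1)$-Souza's atom on $Q\in\bigcup_k\mathcal P^k$ is a function constant on $Q$, zero outside $Q$, with sup norm $\le|Q|^{s-1}$; their set is $\mathcal A^{sz}_{s,1}(Q)$. $\mathcal B^s_{1,1}$ is the set of complex $g\in L^1$ which can be written $g=\sum_k\sum_{Q\in\mathcal P^k}s_Qa_Q$ with $a_Q\in\mathcal A^{sz}_{s,1}(Q)$, $s_Q\in\mathbb C$, $\sum_k|\sum_{Q\in\mathcal P^k}s_Qa_Q|_1<\infty$ and $\sum_k\sum_{Q\in\mathcal P^k}|s_Q|<\infty$; $|g|_{\mathcal B^s_{1,1}}$ is the infimum of $\sum_k\sum_{Q\in\mathcal P^k}|s_Q|$ over all such representations. $M(\mathcal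 B^s_{1,1})$ is the set of pointwise multipliers: measurable $g:I\to\mathbb C$ such that $f\mapsto gf$ defines a bounded operator of $\mathcal B^s_{1,1}$ into itself. $\mathcal B^s_{1,1,selfs}=\{g\in\mathcal B^s_{1,1}:\sup|ga_Q|_{\mathcal B^s_{1,1}}<\infty\}$, where the supremum is over all $Q\in\bigcup_k\mathcal P^k$ and all $a_Q\in\mathcal A^{sz}_{s,1}(Q)$. *)

(* Defs.v *)
From HB Require Import structures.
From mathcomp Require Import all_boot all_order all_algebra.
From mathcomp Require Import all_classical all_reals all_analysis.
From mathcomp Require Import complex.
Set Implicit Arguments.
Unset Strict Implicit.
Unset Printing Implicit Defensive.

Import Order.TTheory GRing.Theory Num.Theory.
Import numFieldNormedType.Exports.

Local Open Scope classical_set_scope.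
Local Open Scope ring_scope.

(* The complex modulus as a real number: on [R[i]], [`|z|] has type [R[i]]. *)
Notation cmod := Normc.normc.

Section souza_besov.
Context d (T : measurableType d) (R : realType).
Variable m : {finite_measure set T -> \bar R}.
Implicit Types (P : nat -> set (set T)) (Q : set T) (s : R).
Implicit Types (f g : T -> R[i]) (a : set T -> T -> R[i]) (c : set T -> R[i]).

Definition good_grid P : Prop :=
  exists l1 l2 : R, 0 < l1 /\ l1 < l2 /\ l2 < 1 /\
    (forall k, finite_set (P k)) /\
    (forall k Q, P k Q -> measurable Q /\ (0 < m Q)%E) /\
    P 0%N = [set setT] /\
    (forall k, m.-negligible (~` \bigcup_(Q in P k) Q)) /\
    (forall k, trivIset (P k) id) /\
    (forall k Q, P k.+1 Q -> exists2 Q', P k Q' & Q `<=` Q') /\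
    (forall k Q Q', P k.+1 Q -> P k Q' -> Q `<=` Q' ->
       l1 <= fine (m Q) / fine (m Q') <= l2) /\
    <<s \bigcup_k P k >> = @measurable d T.

Definition cmeasurable g : Prop :=
  measurable_fun setT (fun x => complex.Re (g x)) /\
  measurable_fun setT (fun x => complex.Im (g x)).

Definition L1norm g : \bar R := (\int[m]_x (cmod (g x))%:E)%E.

Definition L1 g : Prop := cmeasurable g /\ (L1norm g < +oo)%E.

(* The (s,1)-Souza's atoms on [Q]. *)
Definition souza_atom s Q g : Prop :=
  [/\ exists z, forall x, Q x -> g x = z,
      forall x, ~ Q x -> g x = 0 &
      forall x, cmod (g x) <= fine (m Q) `^ (s - 1)].

Definition level P c a (k : nat) (x : T) : R[i] :=
  \sum_(Q \in P k) c Q * a Q x.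

Definition rep_cost P c : \bar R :=
  (\sum_(0 <= k <oo) (\sum_(Q \in P k) cmod (c Q))%:E)%E.

(* [besov_rep P s g c a] : the coefficients [c Q] and the atoms [a Q], for [Q]
   in the union of the [P k], represent the element [g] of L^1; the equality
   between [g] and the sum of the series is equality in L^1. *)
Definition besov_rep P s g c a : Prop :=
  L1 g /\
  (forall k Q, P k Q -> souza_atom s Q (a Q)) /\
  (\sum_(0 <= k <oo) L1norm (level P c a k) < +oo)%E /\
  (rep_cost P c < +oo)%E /\
  (fun n => L1norm (fun x => g x - \sum_(k < n) level P c a k x)) @ \oo
    --> 0%E.

(* B^s_{1,1}, as a set of representatives of classes in L^1. *)
Definition besov P s : set (T -> R[i]) :=
  [set g | exists c a, besov_rep P s g c a].

(* The value is [+oo] exactly when [g] is not in [besov P s]. *)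
Definition besov_norm P s g : \bar R :=
  ereal_inf [set t | exists c a, besov_rep P s g c a /\ t = rep_cost P c].

Definition multipliers P s : set (T -> R[i]) :=
  [set g | cmeasurable g /\
    exists C : R, forall f, besov P s f ->
      besov P s (fun x => g x * f x) /\
      (besov_norm P s (fun x => (g x * f x)%R) <= C%:E * besov_norm P s f)%E].

Definition besov_selfs P s : set (T -> R[i]) :=
  [set g | besov P s g /\
    (ereal_sup [set t | exists k Q b, P k Q /\ souza_atom s Q b /\
       t = besov_norm P s (fun x => (g x * b x)%R)] < +oo)%E].

End souza_besov.

(* Main.v *)
(* Rescaling the values of the atoms, every representation can be taken with the
   canonical atoms kap_Q = |Q|^(s-1) 1_Q at no extra cost, and then it is linear
   in its coefficients.  Since |kap_Q|_1 = |Q|^s <= |I|^s, the space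
   B^s_{1,1} embeds in L^1 and is complete: an L^1-convergent series of
   functions with summable costs is represented by the sum of the coefficients.
   If g is in B^s_{1,1,selfs} and f = sum_Q c_Q kap_Q, then each g kap_Q has a
   representation of cost at most C, so sum_Q c_Q (g kap_Q) has cost at most
   C sum_Q |c_Q|; this series converges to g f in L^1 because the remainders of
   the series of f are dominated a.e. by the tails of the series of moduli,
   whose products with |g| are summable.  Conversely, a multiplier g equals
   g 1 with 1 in B^s_{1,1}, and every atom has norm at most 1. *)

Require Import Defs.
From mathcomp Require Import all_boot all_order all_algebra.
From mathcomp Require Import ring.
From mathcomp Require Import all_classical all_reals all_analysis.
From mathcomp Require Import finmap complex measurable_realfun.
Import Order.TTheory GRing.Theory Num.Theory.
Import numFieldNormedType.Exports.
Local Open Scope classical_set_scope.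
Local Open Scope ring_scope.

Set Implicit Arguments.
Unset Strict Implicit.
Unset Printing Implicit Defensive.

(** * Complex moduli, L^1 norms and limits *)

Section modulus.
Context {R : realType}.
Implicit Types x y z : R[i].

Lemma cmod_ge0 z : 0 <= cmod z.
Proof. by case: z => a b; rewrite /= sqrtr_ge0. Qed.

Lemma cmod0 : cmod (0 : R[i]) = 0.
Proof. exact: Normc.normc0. Qed.

Lemma cmodM x y : cmod (x * y) = cmod x * cmod y.
Proof. exact: Normc.normcM. Qed.

Lemma cmodN x : cmod (- x) = cmod x.
Proof. by case: x => a b; rewrite /= !sqrrN. Qed.

Lemma le_cmodD x y : cmod (x + y) <= cmod x + cmod y.
Proof. exact: (le_normcD (x : Rcomplex R) y). Qed.

Lemma cmodB x y : cmod (x - y) = cmod (y - x).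
Proof. by rewrite -opprB cmodN. Qed.

Lemma le_cmod_sum (I : Type) (r : seq I) (P : pred I) (F : I -> R[i]) :
  cmod (\sum_(i <- r | P i) F i) <= \sum_(i <- r | P i) cmod (F i).
Proof.
elim/big_ind2 : _ => [|x a y b xa yb|//]; first by rewrite cmod0.
by apply: le_trans (le_cmodD _ _) _; rewrite lerD.
Qed.

Lemma le_cmod_ReIm z : cmod z <= `|complex.Re z| + `|complex.Im z|.
Proof.
case: z => a b /=; rewrite -(@ger0_norm _ (`|a| + `|b|)) ?addr_ge0//.
rewrite -[leRHS]sqrtr_sqr ler_sqrt ?sqr_ge0//.
rewrite sqrrD !real_normK ?num_real// -addrA lerD2l.
by rewrite lerDr mulrn_wge0 ?mulr_ge0.
Qed.

Lemma le_Re_cmod z : `|complex.Re z| <= cmod z.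
Proof.
by case: z => a b /=; rewrite -sqrtr_sqr ler_sqrt ?addr_ge0 ?sqr_ge0// lerDl sqr_ge0.
Qed.

Lemma le_Im_cmod z : `|complex.Im z| <= cmod z.
Proof.
by case: z => a b /=; rewrite -sqrtr_sqr ler_sqrt ?addr_ge0 ?sqr_ge0// lerDr sqr_ge0.
Qed.

Lemma cmod_real (x : R) : cmod (x%:C)%C = `|x|.
Proof. by rewrite /= expr0n addr0 sqrtr_sqr. Qed.

Lemma ReD x y : complex.Re (x + y) = complex.Re x + complex.Re y.
Proof. by case: x y => [a b] [c e]. Qed.

Lemma ImD x y : complex.Im (x + y) = complex.Im x + complex.Im y.
Proof. by case: x y => [a b] [c e]. Qed.

Lemma ReM x y : complex.Re (x * y) =
  complex.Re x * complex.Re y - complex.Im x * complex.Im y.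
Proof. by case: x y => [a b] [c e]. Qed.

Lemma ImM x y : complex.Im (x * y) =
  complex.Re x * complex.Im y + complex.Im x * complex.Re y.
Proof. by case: x y => [a b] [c e]. Qed.

End modulus.

Section complex_L1.
Context d (T : measurableType d) (R : realType).
Variable m : {finite_measure set T -> \bar R}.
Implicit Types (f g h : T -> R[i]) (z : R[i]).

Lemma cmeasurable_cst z : cmeasurable (fun=> z : R[i]) (T := T).
Proof. by split; exact: measurable_cst. Qed.

Lemma cmeasurableD f g : cmeasurable f -> cmeasurable g ->
  cmeasurable (fun x => f x + g x).
Proof.
move=> [f1 f2] [g1 g2]; split.
- by under eq_fun do rewrite ReD; exact: measurable_funD.
- by under eq_fun do rewrite ImD; exact: measurable_funD.
Qed.

Lemma cmeasurableM f g : cmeasurable f -> cmeasurable g ->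
  cmeasurable (fun x => f x * g x).
Proof.
move=> [f1 f2] [g1 g2]; split.
- under eq_fun do rewrite ReM.
  by apply: measurable_funB; exact: measurable_funM.
- under eq_fun do rewrite ImM.
  by apply: measurable_funD; exact: measurable_funM.
Qed.

Lemma cmeasurableB f g : cmeasurable f -> cmeasurable g ->
  cmeasurable (fun x => f x - g x).
Proof.
move=> mf mg; under eq_fun do rewrite -[- g _]mulN1r.
by apply: cmeasurableD => //; apply: cmeasurableM => //; exact: cmeasurable_cst.
Qed.

(** Measurability is asked only of the members of [r]: sets are known to be measurable only as
    elements of some [P k]. *)
Lemma cmeasurable_sum (I : eqType) (r : seq I) (F : I -> T -> R[i]) :
  (forall i, i \in r -> cmeasurable (F i)) ->
  cmeasurable (fun x => \sum_(i <- r) F i x).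
Proof.
elim: r => [_|i r IH mF].
  by under eq_fun do rewrite big_nil; exact: cmeasurable_cst.
under eq_fun do rewrite big_cons; apply: cmeasurableD.
  by apply: mF; rewrite mem_head.
by apply: IH => j jr; apply: mF; rewrite in_cons jr orbT.
Qed.

Lemma measurable_cmod f : cmeasurable f -> measurable_fun setT (fun x => cmod (f x)).
Proof.
move=> [f1 f2].
rewrite (_ : (fun _ => _) =
    (@Num.sqrt R) \o (fun x => complex.Re (f x) ^+ 2 + complex.Im (f x) ^+ 2)).
  apply: measurableT_comp.
    by apply: continuous_measurable_fun; exact: sqrt_continuous.
  by apply: measurable_funD; exact: measurable_funX.
by apply/funext => x /=; case: (f x).
Qed.

Lemma measurable_ecmod f : cmeasurable f ->
  measurable_fun setT (fun x => (cmod (f x))%:E).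
Proof. by move=> mf; apply/measurable_EFinP; exact: measurable_cmod. Qed.

Local Notation L1n := (L1norm m).

Lemma L1norm_ge0 f : (0 <= L1n f)%E.
Proof. by apply: integral_ge0 => x _; rewrite lee_fin cmod_ge0. Qed.

Lemma L1norm0 : L1n (fun=> 0) = 0%E.
Proof. by rewrite /L1norm; under eq_integral do rewrite cmod0; exact: integral0. Qed.

Lemma L1normD f g : cmeasurable f -> cmeasurable g ->
  (L1n (fun x => f x + g x)%R <= L1n f + L1n g)%E.
Proof.
move=> mf mg; rewrite /L1norm -ge0_integralD//; first last.
- exact: measurable_ecmod.
- by move=> x _; rewrite lee_fin cmod_ge0.
- exact: measurable_ecmod.
- by move=> x _; rewrite lee_fin cmod_ge0.
apply: ge0_le_integral => //.
- by move=> x _; rewrite lee_fin cmod_ge0.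
- by apply: measurable_ecmod; exact: cmeasurableD.
- by apply: emeasurable_funD; exact: measurable_ecmod.
- by move=> x _; rewrite -EFinD lee_fin le_cmodD.
Qed.

Lemma L1normZ z f : cmeasurable f ->
  L1n (fun x => z * f x) = ((cmod z)%:E * L1n f)%E.
Proof.
move=> mf; rewrite /L1norm -ge0_integralZl//.
- by apply: eq_integral => x _; rewrite cmodM EFinM.
- exact: measurable_ecmod.
- by move=> x _; rewrite lee_fin cmod_ge0.
- by rewrite lee_fin cmod_ge0.
Qed.

Lemma L1norm_sum (I : eqType) (r : seq I) (F : I -> T -> R[i]) :
  (forall i, i \in r -> cmeasurable (F i)) ->
  (L1n (fun x => \sum_(i <- r) F i x)%R <= \sum_(i <- r) L1n (F i))%E.
Proof.
elim: r => [_|i r IH mF].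
  by under [X in L1n X]eq_fun do rewrite big_nil; rewrite L1norm0 big_nil.
under [X in L1n X]eq_fun do rewrite big_cons.
have mi : cmeasurable (F i) by apply: mF; rewrite mem_head.
have mr j : j \in r -> cmeasurable (F j).
  by move=> jr; apply: mF; rewrite in_cons jr orbT.
rewrite big_cons; apply: le_trans (L1normD _ _) _ => //.
  exact: cmeasurable_sum.
by rewrite leeD2l// IH.
Qed.

Lemma L1_cst0 : L1 m (fun=> 0).
Proof. by split; [exact: cmeasurable_cst|rewrite L1norm0 ltry]. Qed.

Lemma L1D f g : L1 m f -> L1 m g -> L1 m (fun x => f x + g x).
Proof.
move=> [mf lf] [mg lg]; split; first exact: cmeasurableD.
by apply: le_lt_trans (L1normD _ _) _ => //; exact: lte_add_pinfty.
Qed.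

Lemma L1Z z f : L1 m f -> L1 m (fun x => z * f x).
Proof.
move=> [mf lf]; split.
  by apply: cmeasurableM => //; exact: cmeasurable_cst.
by rewrite L1normZ// lte_mul_pinfty// lee_fin cmod_ge0.
Qed.

End complex_L1.

(** * Nonnegative extended sequences and absolutely convergent complex series *)

Section limits.
Context {R : realType}.
Implicit Types (u : nat -> \bar R) (z : nat -> R[i]).

(** The bound for [e = 1] makes the sequence eventually finite, which reduces convergence to the
    real case. *)
Lemma cvg0e_leP u : (forall n, (0 <= u n)%E) ->
  u @ \oo --> 0%E <-> forall e : R, 0 < e -> \forall n \near \oo, (u n <= e%:E)%E.
Proof.
move=> u0; split=> [/fine_cvgP[ufin u_to0] e e0|ule].
  apply: (filterS2 _ _ ufin ((cvgr0Pnorm_le _).1 u_to0 e e0)) => n ufinn /=.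
  by rewrite ger0_norm ?fine_ge0// -{2}(fineK ufinn) lee_fin.
have ufin : \forall n \near \oo, u n \is a fin_num.
  apply: filterS (ule 1 ltr01) => n un1.
  by rewrite ge0_fin_numE// (le_lt_trans un1)// ltry.
apply/fine_cvgP; split => //.
apply/cvgr0Pnorm_le => e e0.
apply: (filterS2 _ _ ufin (ule e e0)) => n ufinn /=.
by rewrite ger0_norm ?fine_ge0// -{1}(fineK ufinn) lee_fin.
Qed.

Lemma abs_summable_cvg (v : nat -> R) z : (forall k, `|v k| <= cmod (z k)) ->
  (\sum_(0 <= k <oo) (cmod (z k))%:E < +oo)%E -> cvgn (series v).
Proof.
move=> vz zoo; apply: normed_cvg.
apply: (@series_le_cvg _ _ (fun k => cmod (z k))).
- by move=> k /=.
- by move=> k; exact: cmod_ge0.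
- exact: vz.
have z0 k : (0 <= (cmod (z k))%:E)%E by rewrite lee_fin cmod_ge0.
apply: nondecreasing_is_cvgn.
  by apply: nondecreasing_series => k _ _; exact: cmod_ge0.
exists (fine (\sum_(0 <= k <oo) (cmod (z k))%:E)) => _ [n _ <-].
rewrite -lee_fin fineK; last first.
  by rewrite ge0_fin_numE// nneseries_ge0.
by rewrite /series/= -sumEFin; exact: nneseries_lim_ge.
Qed.

(** The sum is built from its real and imaginary parts. Its distance to the n-th partial sum is at
    most its distance to a far N-th one plus the moduli of the terms between n and N. The explicit
    tail later turns coefficientwise summation into convergence in cost. *)
Lemma abs_summable_sum z : (\sum_(0 <= k <oo) (cmod (z k))%:E < +oo)%E ->
  exists w, forall n, ((cmod (w - \sum_(k < n) z k))%:E <=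
    \sum_(n <= k <oo) (cmod (z k))%:E)%E.
Proof.
move=> zoo.
have cRe : cvgn (series (fun k => complex.Re (z k))).
  by apply: abs_summable_cvg zoo => k; exact: le_Re_cmod.
have cIm : cvgn (series (fun k => complex.Im (z k))).
  by apply: abs_summable_cvg zoo => k; exact: le_Im_cmod.
exists (limn (series (fun k => complex.Re (z k))) +i*
        limn (series (fun k => complex.Im (z k))))%C => n.
set w : R[i] := (_ +i* _)%C.
have z0 k : (0 <= (cmod (z k))%:E)%E by rewrite lee_fin cmod_ge0.
have ReS N : complex.Re (\sum_(k < N) z k) = series (fun k => complex.Re (z k)) N.
  by rewrite /series/= big_mkord; elim/big_ind2 : _ => // x a y b <- <-; rewrite ReD.
have ImS N : complex.Im (\sum_(k < N) z k) = series (fun k => complex.Im (z k)) N.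
  by rewrite /series/= big_mkord; elim/big_ind2 : _ => // x a y b <- <-; rewrite ImD.
apply/lee_addgt0Pr => e e0.
have e20 : 0 < e / 2 by rewrite divr_gt0.
have /cvgrPdist_le/(_ _ e20) hRe := cRe.
have /cvgrPdist_le/(_ _ e20) hIm := cIm.
near \oo => N.
have nN : (n <= N)%N by near: N; exact: nbhs_infty_ge.
have wN : cmod (w - \sum_(k < N) z k) <= e.
  apply: le_trans (le_cmod_ReIm _) _.
  rewrite ReD ImD (splitr e) lerD//.
    rewrite (_ : complex.Re (- _) = - complex.Re (\sum_(k < N) z k)); last first.
      by case: (\sum_(k < N) _).
    by rewrite ReS; near: N.
  rewrite (_ : complex.Im (- _) = - complex.Im (\sum_(k < N) z k)); last first.
    by case: (\sum_(k < N) _).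
  by rewrite ImS; near: N.
rewrite addeC; apply: (@le_trans _ _ (e%:E + (\sum_(n <= k < N) cmod (z k))%:E)%E).
  rewrite -EFinD lee_fin -(subrK (\sum_(k < N) z k) w) -addrA.
  apply: le_trans (le_cmodD _ _) _; rewrite lerD//.
  rewrite -!(big_mkord xpredT z)
    [\sum_(0 <= i < N) z i](big_cat_nat _ nN)//= addrAC subrr add0r.
  exact: le_cmod_sum.
rewrite leeD2l// -sumEFin; exact: nneseries_lim_ge.
Unshelve. all: by end_near. Qed.

End limits.

(** * Products of a measurable function with an L^1-convergent series *)

Section mul_tail.
Context d (T : measurableType d) (R : realType).
Variable m : {finite_measure set T -> \bar R}.
Implicit Types (f g h : T -> R[i]) (l : nat -> T -> R[i]).
Local Notation L1n := (L1norm m).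

Lemma le_cvg0e (a : \bar R) (u : nat -> \bar R) :
  u @ \oo --> 0%E -> (forall n, (a <= u n)%E) -> (a <= 0)%E.
Proof. by move=> u0 au; apply: (cvge_to_ge u0); exact: nearW. Qed.

(* The excess of [cmod f] over the sum of the [cmod (l k)] is dominated by
   [cmod (f - \sum_(k < N) l k)] for every [N], so it vanishes almost
   everywhere. *)
Lemma L1norm_mul_le f g l : cmeasurable f -> cmeasurable g ->
  (forall k, cmeasurable (l k)) ->
  L1n (fun x => f x - \sum_(k < N) l k x) @[N --> \oo] --> 0%E ->
  (L1n (fun x => g x * f x)%R <= \sum_(0 <= k <oo) L1n (fun x => g x * l k x)%R)%E.
Proof.
move=> mf mg ml fl.
pose h x := (\sum_(0 <= k <oo) (cmod (l k x))%:E)%E.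
(* The positive part also covers the points where [h] is infinite: there the difference is [-oo] and
   [phi] is 0. *)
pose phi x := maxe ((cmod (f x))%:E - h x)%E 0%E.
have l0 k x : (0 <= (cmod (l k x))%:E)%E by rewrite lee_fin cmod_ge0.
have h0 x : (0 <= h x)%E by exact: nneseries_ge0.
have mh : measurable_fun setT h.
  by apply: ge0_emeasurable_sum => // k _; exact: measurable_ecmod.
have mphi : measurable_fun setT phi.
  apply: measurable_maxe => //; apply: emeasurable_funB => //.
  exact: measurable_ecmod.
have phi0 x : (0 <= phi x)%E by rewrite /phi le_max lexx orbT.
have mS N : cmeasurable (fun x => f x - \sum_(k < N) l k x).
  by apply: cmeasurableB => //; exact: cmeasurable_sum.
have phi_le N x : (phi x <= (cmod (f x - \sum_(k < N) l k x))%:E)%E.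
  rewrite /phi ge_max lee_fin cmod_ge0 andbT.
  have hN : ((\sum_(k < N) cmod (l k x))%:E <= h x)%E.
    rewrite -(big_mkord xpredT (fun k => cmod (l k x))) -sumEFin.
    exact: nneseries_lim_ge.
  case: (h x) (h0 x) hN => [r _|_ _|//]; last by rewrite leNye.
  rewrite lee_fin -EFinB lee_fin lerBlDr => hN.
  rewrite -[X in cmod X](subrK (\sum_(k < N) l k x)).
  apply: le_trans (le_cmodD _ _) _; rewrite lerD2l.
  exact: le_trans (le_cmod_sum _ _ _) hN.
have iphi : (\int[m]_x phi x = 0)%E.
  apply/eqP; rewrite eq_le integral_ge0// andbT.
  apply: (le_cvg0e fl) => N; apply: ge0_le_integral => //.
  exact: measurable_ecmod.
have /(ae_eq_integral_abs m measurableT mphi) phi_ae :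
    (\int[m]_x `|phi x| = 0)%E.
  by rewrite -iphi; apply: eq_integral => x _; rewrite gee0_abs.
rewrite -integral_nneseries//; first last.
- by move=> k x _; rewrite lee_fin cmod_ge0.
- by move=> k; apply: measurable_ecmod; exact: cmeasurableM.
apply: ae_ge0_le_integral => //.
- by move=> x _; rewrite lee_fin cmod_ge0.
- by apply: measurable_ecmod; exact: cmeasurableM.
- by move=> x _; apply: nneseries_ge0 => k _ _; rewrite lee_fin cmod_ge0.
- apply: ge0_emeasurable_sum => [k x _ _|k _].
    by rewrite lee_fin cmod_ge0.
  by apply: measurable_ecmod; exact: cmeasurableM.
apply: filterS phi_ae => x /(_ I) phix _.
have {phix} fh : ((cmod (f x))%:E <= h x)%E.
  have : (phi x <= 0)%E by rewrite phix.
  by rewrite /phi ge_max sube_le0 => /andP[].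
under eq_eseriesr do rewrite cmodM EFinM.
by rewrite cmodM EFinM nneseriesZl// lee_wpmul2l// lee_fin cmod_ge0.
Qed.

(** The series shifted by [n] converges in L^1 to the n-th remainder of [f], so the previous
    estimate applies to it. When the norms of the products are summable, the right-hand side tends
    to 0 and the series of products converges to [g f]. *)
Lemma L1norm_mul_tail f g l n : cmeasurable f -> cmeasurable g ->
  (forall k, cmeasurable (l k)) ->
  L1n (fun x => f x - \sum_(k < N) l k x) @[N --> \oo] --> 0%E ->
  (L1n (fun x => g x * (f x - \sum_(k < n) l k x))%R <=
   \sum_(n <= k <oo) L1n (fun x => g x * l k x)%R)%E.
Proof.
move=> mf mg ml fl; rewrite -nneseries_addn; last by move=> k; exact: L1norm_ge0.
apply: (@L1norm_mul_le (fun x => f x - \sum_(k < n) l k x) g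
  (fun k => l (k + n)%N)) => //.
  by apply: cmeasurableB => //; exact: cmeasurable_sum.
have := fl; rewrite -(cvg_shiftn n)/=; apply: cvg_trans; apply: near_eq_cvg.
apply: nearW => N; congr (L1n _); apply/funext => x.
rewrite -addrA -opprD addnC big_split_ord/=; congr (_ - (_ + _)).
by apply: eq_bigr => i _; rewrite addnC.
Qed.

End mul_tail.

(** * Representations by canonical atoms *)

Lemma powR_cancel (R : realType) (q s : R) : 0 < q ->
  q `^ (1 - s) * q `^ (s - 1) = 1.
Proof.
move=> q0; rewrite -powRD; last by rewrite (gt_eqF q0) implybT.
by rewrite addrA subrK subrr powRr0.
Qed.

Section canonical.
Context d (T : measurableType d) (R : realType).
Variables (m : {finite_measure set T -> \bar R}) (P : nat -> set (set T)) (s : R).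
Implicit Types (f g h : T -> R[i]) (Q : set T) (c e : set T -> R[i]) (k n : nat).
Local Notation L1n := (L1norm m).

Definition canonical_atom Q (x : T) : R[i] :=
  if `[< Q x >] then ((fine (m Q) `^ (s - 1))%:C)%C else 0.

Local Notation kap := canonical_atom.

Definition canonical_level c k : T -> R[i] := level P c kap k.

Local Notation clevel := canonical_level.

Definition weight c k : R := \sum_(Q \in P k) cmod (c Q).

(* A representation by canonical atoms is linear in the coefficients alone. *)
Definition canonical_rep g c : Prop :=
  [/\ L1 m g, (rep_cost P c < +oo)%E &
      L1n (fun x => g x - \sum_(k < n) clevel c k x) @[n --> \oo] --> 0%E].

Hypothesis Pfin : forall k, finite_set (P k).
Hypothesis Pmeas : forall k Q, P k Q -> measurable Q.
Hypothesis s0 : 0 < s.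

Lemma fset_gridP k Q : (Q \in (fset_set (P k) : seq _)) -> P k Q.
Proof. by rewrite in_fset_set// => /set_mem. Qed.

Lemma canonical_levelE c k x :
  clevel c k x = \sum_(Q <- fset_set (P k)) c Q * kap Q x.
Proof. by rewrite /canonical_level /level fsbig_finite. Qed.

Lemma weightE c k : weight c k = \sum_(Q <- fset_set (P k)) cmod (c Q).
Proof. by rewrite /weight fsbig_finite. Qed.

Lemma weight_ge0 c k : 0 <= weight c k.
Proof. by rewrite weightE sumr_ge0// => Q _; exact: cmod_ge0. Qed.

Lemma rep_cost_ge0 c : (0 <= rep_cost P c)%E.
Proof. by apply: nneseries_ge0 => k _ _; rewrite lee_fin; exact: weight_ge0. Qed.

Lemma cmod_canonical_atom Q x : Q x -> cmod (kap Q x) = fine (m Q) `^ (s - 1).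
Proof.
by move=> Qx; rewrite /kap asboolT// cmod_real ger0_norm// powR_ge0.
Qed.

Lemma canonical_atom_out Q x : ~ Q x -> kap Q x = 0.
Proof. by move=> Qx; rewrite /kap asboolF. Qed.

Lemma souza_atom_canonical Q : souza_atom m s Q (kap Q).
Proof.
split=> [|x|x]; last 2 first.
- exact: canonical_atom_out.
- have [/cmod_canonical_atom->//|Qx] := pselect (Q x).
  by rewrite canonical_atom_out// cmod0 powR_ge0.
by exists ((fine (m Q) `^ (s - 1))%:C)%C => x Qx; rewrite /kap asboolT.
Qed.

Lemma canonical_atomE Q x :
  kap Q x = ((fine (m Q) `^ (s - 1) * \1_Q x)%:C)%C.
Proof.
rewrite /kap indicE; case: asboolP => Qx; first by rewrite mem_set// mulr1.
by rewrite memNset// mulr0.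
Qed.

Lemma cmeasurable_canonical_atom Q : measurable Q -> cmeasurable (kap Q).
Proof.
move=> mQ; rewrite (funext (canonical_atomE Q)).
split => /=; last exact: measurable_cst.
by apply: measurable_funM; [exact: measurable_cst|exact: measurable_indic].
Qed.

(** Bounds the embedding of the Besov space into L^1: the canonical atom of Q has L^1 norm |Q|^s, at
    most |I|^s because s > 0. *)
Definition embedding_const : R := fine (m setT) `^ s.
Local Notation K0 := embedding_const.

Lemma embedding_const_ge0 : 0 <= K0. Proof. exact: powR_ge0. Qed.

Lemma L1norm_canonical_atom Q : measurable Q -> (L1n (kap Q) <= K0%:E)%E.
Proof.
move=> mQ.
have mQfin A : measurable A -> (m A) \is a fin_num by move=> mA; exact: fin_num_measure.
have -> : L1n (kap Q) = (fine (m Q) `^ s)%:E.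
  rewrite /L1norm.
  transitivity (\int[m]_x ((fine (m Q) `^ (s - 1))%:E * (\1_Q x)%:E))%E.
    apply: eq_integral => x _; rewrite canonical_atomE cmod_real ger0_norm//.
    by rewrite mulr_ge0// ?powR_ge0// indicE ler0n.
  rewrite ge0_integralZl//; first last.
  - by rewrite lee_fin powR_ge0.
  - by apply/measurable_EFinP; exact: measurable_indic.
  rewrite integral_indic// setIT.
  transitivity ((fine (m Q) `^ (s - 1))%:E * (fine (m Q))%:E)%E.
    by congr (_ * _)%E; rewrite fineK// mQfin.
  rewrite -EFinM; congr EFin; have : 0 <= fine (m Q) by exact: fine_ge0.
  (* A null Q is treated apart: both sides vanish because s is nonzero, whereas adding exponents
     requires |Q| > 0. *)
  rewrite le_eqVlt => /predU1P[<-|Q0]; first by rewrite mulr0 powR0// gt_eqF.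
  by rewrite -[X in _ * X]powRr1 ?ltW// -powRD ?subrK// gt_eqF ?implybT.
rewrite lee_fin ge0_ler_powR ?nnegrE ?fine_ge0 ?(ltW s0)//.
by apply: fine_le; rewrite ?mQfin//; apply: le_measure; rewrite ?inE//; apply: mem_set.
Qed.

Lemma cmeasurable_canonical_level c k : cmeasurable (clevel c k).
Proof.
rewrite (funext (canonical_levelE c k)).
apply: cmeasurable_sum => Q /fset_gridP/Pmeas mQ.
by apply: cmeasurableM; [exact: cmeasurable_cst|exact: cmeasurable_canonical_atom].
Qed.

Lemma cmeasurable_partial c n : cmeasurable (fun x => \sum_(k < n) clevel c k x).
Proof. by apply: cmeasurable_sum => k _; exact: cmeasurable_canonical_level. Qed.

Lemma L1norm_canonical_level c k : (L1n (clevel c k) <= (K0 * weight c k)%:E)%E.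
Proof.
rewrite (funext (canonical_levelE c k)).
have mQk Q : Q \in (fset_set (P k) : seq _) -> cmeasurable (kap Q).
  by move=> /fset_gridP/Pmeas mQ; exact: cmeasurable_canonical_atom.
apply: le_trans (L1norm_sum _ _) _.
  by move=> Q Qk; apply: cmeasurableM; [exact: cmeasurable_cst|exact: mQk].
rewrite weightE mulr_sumr -sumEFin big_seq [leRHS]big_seq; apply: lee_sum => Q Qk.
rewrite L1normZ; last exact: mQk.
rewrite EFinM muleC lee_wpmul2r ?lee_fin ?cmod_ge0//.
by apply: L1norm_canonical_atom; exact: Pmeas (fset_gridP Qk).
Qed.

(** With canonical atoms, finite cost alone yields the summability of the L^1 norms of the levels
    that [besov_rep] demands. *)
Lemma sum_L1norm_canonical_level c :
  (\sum_(0 <= k <oo) L1n (clevel c k) <= K0%:E * rep_cost P c)%E.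
Proof.
rewrite /rep_cost -nneseriesZl; last by move=> k _; rewrite lee_fin; exact: weight_ge0.
apply: lee_nneseries => k _; first by move=> _; exact: L1norm_ge0.
by rewrite -EFinM; exact: L1norm_canonical_level.
Qed.

Lemma besov_rep_canonical g c : canonical_rep g c -> besov_rep m P s g c kap.
Proof.
move=> [L1g coo gc]; split => //; split.
  by move=> k Q _; exact: souza_atom_canonical.
split; last by [].
apply: le_lt_trans (sum_L1norm_canonical_level c) _.
by rewrite lte_mul_pinfty// lee_fin embedding_const_ge0.
Qed.

(** This is the embedding into L^1, read off from the product estimate with the constant multiplier
    1. *)
Lemma canonical_rep_le g c : canonical_rep g c ->
  (L1n g <= K0%:E * rep_cost P c)%E.
Proof.
move=> [[mg _] _ gc]; apply: le_trans (sum_L1norm_canonical_level c).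
have mul1 h : (fun x => 1 * h x) = h by apply/funext => x; rewrite mul1r.
have := L1norm_mul_le mg (cmeasurable_cst T 1) (cmeasurable_canonical_level c) gc.
by rewrite mul1; under eq_eseriesr do rewrite mul1.
Qed.

(* On each [Q] the atom [a Q] is a multiple of the canonical atom, with a factor
   of modulus at most one. *)
Lemma canonical_rep_of_besov_rep g c a : (forall k Q, P k Q -> (0 < m Q)%E) ->
  besov_rep m P s g c a ->
  exists2 e, canonical_rep g e & (rep_cost P e <= rep_cost P c)%E.
Proof.
move=> Ppos [L1g [aat [_ [coo gc]]]].
(* [z Q] is the value of [a Q] on Q; the default 0 serves the sets outside the grid and the empty
   set. *)
have /choice[z az] Q : exists z : R[i], forall k, P k Q ->
    (forall x, Q x -> a Q x = z) /\ cmod z <= fine (m Q) `^ (s - 1).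
  have [[k kQ]|nQ] := pselect (exists k, P k Q); last first.
    by exists 0 => k kQ; case: nQ; exists k.
  have [[z az] _ zle] := aat _ _ kQ.
  have [[x Qx]|nx] := pselect (exists x, Q x).
    by exists z => _ _; split=> //; rewrite -(az _ Qx).
  exists 0 => _ _; split=> [x Qx|]; first by case: nx; exists x.
  by rewrite cmod0 powR_ge0.
(* The factor |Q|^(1-s) inverts the height of the canonical atom, so that [e Q] times this atom is
   [c Q] times [a Q]. *)
pose e Q := c Q * (z Q * ((fine (m Q) `^ (1 - s))%:C)%C).
have mQ0 k Q : P k Q -> 0 < fine (m Q).
  move=> kQ; rewrite fine_gt0// (Ppos _ _ kQ) /=.
  by rewrite -ge0_fin_numE// fin_num_measure//; exact: Pmeas kQ.
have powK k Q : P k Q -> fine (m Q) `^ (1 - s) * fine (m Q) `^ (s - 1) = 1.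
  by move=> kQ; apply: powR_cancel; exact: mQ0 kQ.
have ce k Q : P k Q -> cmod (e Q) <= cmod (c Q).
  move=> kQ; rewrite /e cmodM ler_piMr ?cmod_ge0// cmodM cmod_real.
  rewrite ger0_norm ?powR_ge0//; have [_ zle] := az _ _ kQ.
  apply: le_trans (ler_wpM2r (powR_ge0 _ _) zle) _.
  by rewrite mulrC (powK _ _ kQ).
have ea k : clevel e k = level P c a k.
  apply/funext => x; rewrite canonical_levelE /level fsbig_finite//.
  apply: eq_big_seq => Q /fset_gridP kQ.
  have [Qa _] := az _ _ kQ; have [_ aout _] := aat _ _ kQ.
  have [Qx|Qx] := pselect (Q x); last by rewrite canonical_atom_out// aout// !mulr0.
  rewrite (Qa _ Qx) /e /kap asboolT// -!mulrA -rmorphM/= (powK _ _ kQ).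
  by rewrite mulr1.
have cost_e : (rep_cost P e <= rep_cost P c)%E.
  apply: lee_nneseries => k _; first by move=> _; rewrite lee_fin; exact: weight_ge0.
  rewrite lee_fin -!/(weight _ _) !weightE big_seq [leRHS]big_seq.
  by apply: ler_sum => Q /fset_gridP; exact: ce.
exists e => //; split => //; first exact: le_lt_trans coo.
by under eq_fun do under [X in L1n X]eq_fun do under eq_bigr do rewrite ea.
Qed.

End canonical.

(** * Linearity of canonical representations and passage to the limit *)

Section completeness.
Context d (T : measurableType d) (R : realType).
Variables (m : {finite_measure set T -> \bar R}) (P : nat -> set (set T)) (s : R).
Implicit Types (f g h F : T -> R[i]) (Q : set T) (c e : set T -> R[i]) (k n : nat).
Hypothesis Pfin : forall k, finite_set (P k).
Hypothesis Pmeas : forall k Q, P k Q -> measurable Q.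
Hypothesis s0 : 0 < s.
Local Notation L1n := (L1norm m).
Local Notation clevel := (canonical_level m P s).
Local Notation crep := (canonical_rep m P s).
Local Notation K0 := (embedding_const m s).

Let weight0 c k : 0 <= weight P c k. Proof. exact: weight_ge0. Qed.
Let cost0 c : (0 <= rep_cost P c)%E. Proof. exact: rep_cost_ge0. Qed.
Let mpartial c n : cmeasurable (fun x => \sum_(k < n) clevel c k x).
Proof. exact: cmeasurable_partial. Qed.

Lemma canonical_levelD c e k x :
  clevel (fun Q => c Q + e Q) k x = clevel c k x + clevel e k x.
Proof.
rewrite !canonical_levelE// -big_split/=; apply: eq_bigr => Q _.
by rewrite mulrDl.
Qed.

Lemma canonical_levelZ (z : R[i]) c k x :
  clevel (fun Q => z * c Q) k x = z * clevel c k x.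
Proof.
rewrite !canonical_levelE// mulr_sumr; apply: eq_bigr => Q _.
by rewrite mulrA.
Qed.

Lemma rep_costD c e :
  (rep_cost P (fun Q => c Q + e Q)%R <= rep_cost P c + rep_cost P e)%E.
Proof.
rewrite /rep_cost -nneseriesD; [|by move=> k _ _; rewrite lee_fin; exact: weight0..].
apply: lee_nneseries => k _; first by move=> _; rewrite lee_fin; exact: weight0.
rewrite -EFinD lee_fin -!/(weight _ _ _) !weightE// -big_split/=.
by apply: ler_sum => Q _; exact: le_cmodD.
Qed.

Lemma rep_costZ (z : R[i]) c :
  rep_cost P (fun Q => z * c Q) = ((cmod z)%:E * rep_cost P c)%E.
Proof.
rewrite /rep_cost -nneseriesZl; last by move=> k _; rewrite lee_fin; exact: weight0.
apply: eq_eseriesr => k _; rewrite -EFinM -!/(weight _ _ _) !weightE// mulr_sumr.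
by congr EFin; apply: eq_bigr => Q _; rewrite cmodM.
Qed.

Lemma rep_cost_cst0 : rep_cost P (fun=> 0 : R[i]) = 0%E.
Proof.
rewrite /rep_cost eseries0// => k _ _; rewrite -/(weight _ _ _) weightE//.
by rewrite big1// => Q _; rewrite cmod0.
Qed.

Lemma canonical_rep0 : crep (fun=> 0) (fun=> 0).
Proof.
split; [exact: L1_cst0|by rewrite rep_cost_cst0 ltry|].
rewrite (_ : (fun _ => _) = fun=> 0%E); first exact: cvg_cst.
apply/funext => n; rewrite -[RHS](L1norm0 m); congr (L1norm m _).
apply/funext => x; rewrite big1 ?subr0// => k _.
by rewrite canonical_levelE// big1// => Q _; rewrite mul0r.
Qed.

Lemma canonical_repD g h c e : crep g c -> crep h e ->
  crep (fun x => g x + h x) (fun Q => c Q + e Q).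
Proof.
move=> [Lg coo gc] [Lh eoo he]; split; first exact: L1D.
  by apply: le_lt_trans (rep_costD _ _) _; exact: lte_add_pinfty.
have := cvgeD _ gc he; rewrite add0e => /(_ _ isT) ghce.
apply: squeeze_cvge (cvg_cst 0%E) ghce; apply: nearW => n.
apply/andP; split; first exact: L1norm_ge0.
have mg : cmeasurable (fun x => g x - \sum_(k < n) clevel c k x).
  by apply: cmeasurableB => //; case: Lg.
have mh : cmeasurable (fun x => h x - \sum_(k < n) clevel e k x).
  by apply: cmeasurableB => //; case: Lh.
apply: le_trans (L1normD m mg mh); rewrite le_eqVlt; apply/orP; left; apply/eqP.
congr (L1norm m _); apply/funext => x.
rewrite addrACA -opprD -big_split/=; congr (_ - _).
by apply: eq_bigr => k _; rewrite canonical_levelD.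
Qed.

Lemma canonical_repZ (z : R[i]) g c : crep g c ->
  crep (fun x => z * g x) (fun Q => z * c Q).
Proof.
move=> [Lg coo gc]; split; first exact: L1Z.
  by rewrite rep_costZ lte_mul_pinfty// lee_fin cmod_ge0.
have := cvgeZl (y := (cmod z)%:E) isT gc; rewrite mule0; apply: cvg_trans.
apply: near_eq_cvg; apply: nearW => n; rewrite -L1normZ; last first.
  by apply: cmeasurableB => //; case: Lg.
congr (L1norm m _); apply/funext => x.
rewrite mulrBr mulr_sumr; congr (_ - _).
by apply: eq_bigr => k _; rewrite canonical_levelZ.
Qed.

Lemma canonical_rep_sum (I : eqType) (r : seq I) (z : I -> R[i])
    (h : I -> T -> R[i]) (e : I -> set T -> R[i]) :
  (forall i, i \in r -> crep (h i) (e i)) ->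
  crep (fun x => \sum_(i <- r) z i * h i x) (fun Q => \sum_(i <- r) z i * e i Q).
Proof.
elim: r => [_|i r IH he].
  under [X in crep X _]eq_fun do rewrite big_nil.
  by under [X in crep _ X]eq_fun do rewrite big_nil; exact: canonical_rep0.
under [X in crep X _]eq_fun do rewrite big_cons.
under [X in crep _ X]eq_fun do rewrite big_cons.
apply: canonical_repD; first by apply: canonical_repZ; apply: he; rewrite mem_head.
by apply: IH => j jr; apply: he; rewrite in_cons jr orbT.
Qed.

Lemma rep_cost_sum (I : Type) (r : seq I) (z : I -> R[i]) (e : I -> set T -> R[i]) :
  (rep_cost P (fun Q => \sum_(i <- r) z i * e i Q)%R <=
   \sum_(i <- r) (cmod (z i))%:E * rep_cost P (e i))%E.
Proof.
elim: r => [|i r IH].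
  by under [X in rep_cost _ X]eq_fun do rewrite big_nil; rewrite rep_cost_cst0 big_nil.
under [X in rep_cost _ X]eq_fun do rewrite big_cons.
rewrite big_cons; apply: le_trans (rep_costD _ _) _.
by rewrite rep_costZ leeD2l.
Qed.

(** The bound is uniform in [n], which lets a small change of the coefficients be absorbed in all
    partial sums at once. *)
Lemma L1norm_partial_le c n :
  (L1n (fun x => \sum_(k < n) clevel c k x)%R <= K0%:E * rep_cost P c)%E.
Proof.
have mc k : cmeasurable (clevel c k) by exact: cmeasurable_canonical_level.
apply: le_trans (sum_L1norm_canonical_level m Pfin Pmeas s0 c).
apply: (@le_trans _ _ (\sum_(k < n) L1n (clevel c k))%E).
  exact: L1norm_sum.
rewrite -(big_mkord xpredT (fun k => L1n (clevel c k))).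
by apply: nneseries_lim_ge => k _ _; exact: L1norm_ge0.
Qed.

(** An e/3 argument: F minus a partial sum for [c] splits into F - G_K, the remainder of G_K in its
    own representation, and a partial sum for C_K - c. The first and third terms are small for a
    large K, the third uniformly in n; then n is taken large for this K. *)
Lemma canonical_rep_lim F (G : nat -> T -> R[i]) (C : nat -> set T -> R[i]) c :
  L1 m F -> (forall n, crep (G n) (C n)) ->
  L1n (fun x => F x - G n x) @[n --> \oo] --> 0%E ->
  rep_cost P (fun Q => C n Q - c Q) @[n --> \oo] --> 0%E ->
  crep F c.
Proof.
move=> LF GC FG Cc; split => //.
  have /cvg0e_leP -/(_ (fun n => cost0 _) 1 ltr01)[N _ /(_ N (leqnn N)) CN] := Cc.
  have [_ CNoo _] := GC N.
  (* The cost of [c] is finite because both C_N and C_N - c have finite cost, the latter at most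
     1. *)
  rewrite (_ : c = fun Q => C N Q + (-1) * (C N Q - c Q)); last first.
    by apply/funext => Q; rewrite mulN1r subKr.
  apply: le_lt_trans (rep_costD _ _) _; rewrite rep_costZ cmodN.
  apply: lte_add_pinfty => //; rewrite lte_mul_pinfty ?lee_fin ?cmod_ge0//.
  exact: le_lt_trans CN (ltry _).
apply/cvg0e_leP => [n|e e0]; first exact: L1norm_ge0.
have e30 : 0 < e / 3 by rewrite divr_gt0.
have KCc := cvgeZl (y := K0%:E) isT Cc; rewrite mule0 in KCc.
have K0ge : (0 <= K0%:E)%E by rewrite lee_fin embedding_const_ge0.
have /cvg0e_leP -/(_ (fun n => mule_ge0 K0ge (cost0 _)) _ e30) hC := KCc.
have /cvg0e_leP -/(_ (fun n => L1norm_ge0 _ _) _ e30) hG := FG.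
near \oo => K.
have [[mGK _] _ /cvg0e_leP -/(_ (fun n => L1norm_ge0 _ _) _ e30) GCK] := GC K.
have mF : cmeasurable F by case: LF.
apply: filterS GCK => n GCKn.
rewrite (_ : (fun x => _) = fun x => (F x - G K x) +
   ((G K x - \sum_(k < n) clevel (C K) k x) +
     \sum_(k < n) clevel (fun Q => C K Q - c Q) k x)); last first.
  apply/funext => x.
  have -> : \sum_(k < n) clevel (C K) k x = \sum_(k < n) clevel c k x +
      \sum_(k < n) clevel (fun Q => C K Q - c Q) k x.
    rewrite -big_split/=; apply: eq_bigr => k _; rewrite -canonical_levelD.
    by congr (canonical_level _ _ _ _ _ _); apply/funext => Q; rewrite addrC subrK.
  by rewrite opprD !addrA !subrK.
have mGC : cmeasurable (fun x => G K x - \sum_(k < n) clevel (C K) k x).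
  exact: cmeasurableB.
have mD : cmeasurable (fun x => \sum_(k < n) clevel (fun Q => C K Q - c Q) k x) by [].
apply: le_trans (L1normD m (cmeasurableB mF mGK) (cmeasurableD mGC mD)) _.
have -> : e = e / 3 + (e / 3 + e / 3) by field.
rewrite !EFinD leeD//; first by near: K.
apply: le_trans (L1normD m mGC mD) _; rewrite leeD//.
by apply: le_trans (L1norm_partial_le _ _) _; near: K.
Unshelve. all: by end_near. Qed.

End completeness.

(** * Summation of series of representations, and multiplication by g *)

Section series.
Context d (T : measurableType d) (R : realType).
Variables (m : {finite_measure set T -> \bar R}) (P : nat -> set (set T)) (s : R).
Implicit Types (f g h F : T -> R[i]) (Q : set T) (c e : set T -> R[i]) (k n : nat).
Hypothesis Pfin : forall k, finite_set (P k).
Hypothesis Pmeas : forall k Q, P k Q -> measurable Q.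
Hypothesis s0 : 0 < s.
Local Notation L1n := (L1norm m).
Local Notation clevel := (canonical_level m P s).
Local Notation kap := (canonical_atom m s).
Local Notation crep := (canonical_rep m P s).
Local Notation K0 := (embedding_const m s).

Let weight0 c k : 0 <= weight P c k. Proof. exact: weight_ge0. Qed.
Let cost0 c : (0 <= rep_cost P c)%E. Proof. exact: rep_cost_ge0. Qed.

Lemma coef_le_rep_cost c k Q : P k Q -> ((cmod (c Q))%:E <= rep_cost P c)%E.
Proof.
move=> kQ; apply: (@le_trans _ _ (weight P c k)%:E).
  rewrite lee_fin weightE// (big_rem Q)/=; last first.
    by rewrite in_fset_set//; exact: mem_set.
  by rewrite lerDl sumr_ge0// => J _; exact: cmod_ge0.
apply: (@le_trans _ _ (\sum_(0 <= j < k.+1) (weight P c j)%:E)%E).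
  by rewrite big_nat_recr//= leeDr// sume_ge0// => j _; rewrite lee_fin; exact: weight0.
by apply: nneseries_lim_ge => j _ _; rewrite lee_fin; exact: weight0.
Qed.

(** Countable subadditivity of the cost, by exchanging sums of nonnegative terms. The offset [n]
    allows both the whole series and its tails. *)
Lemma rep_cost_le_series n e (c : nat -> set T -> R[i]) :
  (forall k Q, P k Q -> ((cmod (e Q))%:E <= \sum_(n <= i <oo) (cmod (c i Q))%:E)%E) ->
  (rep_cost P e <= \sum_(n <= i <oo) rep_cost P (c i))%E.
Proof.
move=> ec.
rewrite -nneseries_addn; last by move=> i; exact: cost0.
rewrite /rep_cost nneseries_interchange; last first.
  by move=> i j; rewrite lee_fin; exact: weight0.
apply: lee_nneseries => k _; first by move=> _; rewrite lee_fin; exact: weight0.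
have -> : (\sum_(0 <= i <oo) (\sum_(Q \in P k) cmod (c (i + n)%N Q))%:E =
    \sum_(Q <- fset_set (P k)) \sum_(0 <= i <oo) (cmod (c (i + n)%N Q))%:E)%E.
  rewrite -nneseries_sum; last by move=> Q i _; rewrite lee_fin cmod_ge0.
  by apply: eq_eseriesr => i _; rewrite -/(weight _ _ _) weightE// sumEFin.
rewrite -/(weight _ _ _) weightE// -sumEFin big_seq [leRHS]big_seq.
apply: lee_sum => Q /(fset_gridP Pfin)/ec.
by rewrite -nneseries_addn// => i; rewrite lee_fin cmod_ge0.
Qed.

(** Completeness: the coefficients are summed set by set, which is possible because each is bounded
    by the cost. The partial sums of the coefficients then converge in cost, their error being at
    most a tail of the convergent series of costs, and the limit lemma applies. *)
Lemma canonical_rep_series F (f : nat -> T -> R[i]) (c : nat -> set T -> R[i]) :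
  L1 m F -> (forall k, crep (f k) (c k)) ->
  (\sum_(0 <= k <oo) rep_cost P (c k) < +oo)%E ->
  L1n (fun x => F x - \sum_(k < n) f k x) @[n --> \oo] --> 0%E ->
  exists2 e, crep F e & (rep_cost P e <= \sum_(0 <= k <oo) rep_cost P (c k))%E.
Proof.
move=> LF fc coo Ff.
have /choice[e ce] Q : exists w, forall k, P k Q -> forall n,
    ((cmod (\sum_(i < n) c i Q - w))%:E <= \sum_(n <= i <oo) (cmod (c i Q))%:E)%E.
  have [[k kQ]|nQ] := pselect (exists k, P k Q); last first.
    by exists 0 => k kQ; case: nQ; exists k.
  have /abs_summable_sum[w wc] : (\sum_(0 <= i <oo) (cmod (c i Q))%:E < +oo)%E.
    apply: le_lt_trans coo; apply: lee_nneseries => i _.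
      by move=> _; rewrite lee_fin cmod_ge0.
    exact: coef_le_rep_cost kQ.
  by exists w => _ _ n; rewrite cmodB; exact: wc.
pose C n Q := \sum_(i < n) c i Q.
have Cle n : (rep_cost P (fun Q => C n Q - e Q)%R <=
    \sum_(n <= i <oo) rep_cost P (c i))%E.
  by apply: rep_cost_le_series => k Q kQ; exact: ce kQ n.
exists e.
  apply: (@canonical_rep_lim _ _ _ m P s Pfin Pmeas s0 F
    (fun n x => \sum_(i < n) f i x) C) => //.
    move=> n; have := @canonical_rep_sum _ _ _ m P s Pfin Pmeas _
      (index_enum 'I_n) (fun=> 1) (fun i => f i) (fun i => c i) (fun i _ => fc i).
    by under eq_fun do under eq_bigr do rewrite mul1r;
       under [X in crep _ X]eq_fun do under eq_bigr do rewrite mul1r.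
  have := nneseries_tail_cvg coo (fun k _ => cost0 _).
  by apply: squeeze_cvge (cvg_cst 0%E); apply: nearW => n; rewrite cost0/=.
(* For n = 0 the partial sum of coefficients is empty, so the tail estimate bounds the cost of -e,
   hence that of e. *)
have := Cle 0%N; rewrite (_ : (fun Q => _) = fun Q => (-1) * e Q); last first.
  by apply/funext => Q; rewrite /C big_ord0 sub0r mulN1r.
rewrite rep_costZ// cmodN (_ : cmod 1 = 1) ?mul1e//.
exact: Normc.normc1.
Qed.

(** Each level of f is a finite combination of canonical atoms, so its product with g is represented
    by the same combination of the representations of the products g kap_Q, at a cost of at most C
    times the weight of the level. These costs are summable over the levels. *)
Lemma canonical_rep_mul g f c (C : R) : 0 <= C -> cmeasurable g ->
  (forall k Q, P k Q -> exists2 e, crep (fun x => g x * kap Q x) e &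
     (rep_cost P e <= C%:E)%E) ->
  crep f c ->
  exists2 e, crep (fun x => g x * f x) e & (rep_cost P e <= C%:E * rep_cost P c)%E.
Proof.
move=> C0 mg gkap [[mf _] coo fc].
have /choice[D gD] Q : exists e, forall k, P k Q ->
    crep (fun x => g x * kap Q x) e /\ (rep_cost P e <= C%:E)%E.
  have [[k kQ]|nQ] := pselect (exists k, P k Q); last first.
    by exists (fun=> 0) => k kQ; case: nQ; exists k.
  by have [e ge eC] := gkap _ _ kQ; exists e.
pose gl k x := g x * clevel c k x.
pose cD k J := \sum_(Q <- fset_set (P k)) c Q * D Q J.
have glD k : crep (gl k) (cD k).
  rewrite (_ : gl k = fun x => \sum_(Q <- fset_set (P k)) c Q * (g x * kap Q x)).
    by apply: canonical_rep_sum => // Q /(fset_gridP Pfin) kQ; case: (gD _ _ kQ).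
  apply/funext => x; rewrite /gl canonical_levelE// mulr_sumr.
  by apply: eq_bigr => Q _; rewrite mulrCA.
have cDle k : (rep_cost P (cD k) <= C%:E * (weight P c k)%:E)%E.
  apply: le_trans (rep_cost_sum Pfin _ _ _) _.
  rewrite weightE// -sumEFin ge0_sume_distrr; last first.
    by move=> Q _; rewrite lee_fin cmod_ge0.
  rewrite big_seq [leRHS]big_seq; apply: lee_sum => Q /(fset_gridP Pfin) kQ.
  by rewrite muleC lee_wpmul2r ?lee_fin ?cmod_ge0//; case: (gD _ _ kQ).
have sum_cD : (\sum_(0 <= k <oo) rep_cost P (cD k) <= C%:E * rep_cost P c)%E.
  rewrite /rep_cost -nneseriesZl; last by move=> k _; rewrite lee_fin; exact: weight0.
  apply: lee_nneseries => k _; first by move=> _; exact: cost0.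
  exact: cDle.
have sum_cDoo : (\sum_(0 <= k <oo) rep_cost P (cD k) < +oo)%E.
  by apply: le_lt_trans sum_cD _; rewrite lte_mul_pinfty// lee_fin.
(* Since g is only measurable, neither the integrability of [g f] nor the convergence to it is
   automatic. Both come from this sum, finite by the embedding applied to each product [gl k]. *)
have sum_gl : (\sum_(0 <= k <oo) L1n (gl k) < +oo)%E.
  apply: (@le_lt_trans _ _ (K0%:E * \sum_(0 <= k <oo) rep_cost P (cD k))%E).
    rewrite -nneseriesZl; last by move=> k _; exact: cost0.
    apply: lee_nneseries => k _; first by move=> _; exact: L1norm_ge0.
    exact: canonical_rep_le.
  by rewrite lte_mul_pinfty// lee_fin embedding_const_ge0.
have ml k : cmeasurable (clevel c k) by exact: cmeasurable_canonical_level.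
have Lgf : L1 m (fun x => g x * f x).
  split; first exact: cmeasurableM.
  by apply: le_lt_trans sum_gl; exact: L1norm_mul_le.
have gfl : L1n (fun x => g x * f x - \sum_(k < n) gl k x) @[n --> \oo] --> 0%E.
  have := nneseries_tail_cvg sum_gl (fun k _ => L1norm_ge0 m _).
  apply: squeeze_cvge (cvg_cst 0%E); apply: nearW => n; rewrite L1norm_ge0/=.
  rewrite (_ : (fun x => _) = fun x => g x * (f x - \sum_(k < n) clevel c k x)).
    exact: L1norm_mul_tail.
  by apply/funext => x; rewrite mulrBr mulr_sumr.
have [e ge ele] := canonical_rep_series Lgf glD sum_cDoo gfl.
by exists e => //; exact: le_trans ele sum_cD.
Qed.

End series.

(** * Levels of the grid and the two inclusions *)

Section grid.
Context d (T : measurableType d) (R : realType).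
Variables (m : {finite_measure set T -> \bar R}) (P : nat -> set (set T)) (s : R).
Hypothesis gP : good_grid m P.
Hypothesis s0 : 0 < s.
Implicit Types (f g b : T -> R[i]) (Q : set T) (c e : set T -> R[i]) (k n : nat).
Local Notation clevel := (canonical_level m P s).
Local Notation kap := (canonical_atom m s).
Local Notation crep := (canonical_rep m P s).

Lemma grid_finite k : finite_set (P k).
Proof. by case: gP => l1 [l2 [_ [_ [_ [+ _]]]]]. Qed.

Lemma grid_measurable k Q : P k Q -> measurable Q.
Proof. by case: gP => l1 [l2 [_ [_ [_ [_ [+ _]]]]]] => /[apply] -[]. Qed.

Lemma grid_gt0 k Q : P k Q -> (0 < m Q)%E.
Proof. by case: gP => l1 [l2 [_ [_ [_ [_ [+ _]]]]]] => /[apply] -[]. Qed.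

Lemma grid0 : P 0%N setT.
Proof. by case: gP => l1 [l2 [_ [_ [_ [_ [_ [-> _]]]]]]]. Qed.

Lemma grid_fine_gt0 k Q : P k Q -> 0 < fine (m Q).
Proof.
move=> kQ; rewrite fine_gt0// (grid_gt0 kQ) /=.
by rewrite -ge0_fin_numE// fin_num_measure//; exact: grid_measurable kQ.
Qed.

(** Each step up the grid strictly increases the measure, since the ratio is at most l2 < 1; the
    [i.+1] guarantees at least one step. *)
Lemma grid_ancestor j i Q : P (j + i.+1)%N Q ->
  exists2 Q', P j Q' & Q `<=` Q' /\ fine (m Q) < fine (m Q').
Proof.
have [l1 [l2 [_ [_ [l21 [_ [_ [_ [_ [_ [sub [ratio _]]]]]]]]]]]] := gP.
elim: i Q => [|i IH] Q; rewrite addnS => PQ.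
  have [Q' PQ' QQ'] := sub _ _ PQ; rewrite addn0 in PQ PQ'.
  exists Q' => //; split => //.
  have /andP[_ le2] := ratio _ _ _ PQ PQ' QQ'.
  have Q'0 := grid_fine_gt0 PQ'.
  by have := le_lt_trans le2 l21; rewrite ltr_pdivrMr// mul1r.
have [Q1 PQ1 QQ1] := sub _ _ PQ.
have [Q' PQ' [Q1Q' mQ1]] := IH _ PQ1.
exists Q' => //; split; first exact: subset_trans Q1Q'.
apply: lt_trans mQ1; have /andP[_ le2] := ratio _ _ _ PQ PQ1 QQ1.
have Q10 := grid_fine_gt0 PQ1.
by have := le_lt_trans le2 l21; rewrite ltr_pdivrMr// mul1r.
Qed.

(** A set lying also at a later level would meet its ancestor at level j, being of positive measure;
    disjointness would make the two equal, against the strict inequality of measures. *)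
Lemma grid_level_lt j k Q : (j < k)%N -> P j Q -> ~ P k Q.
Proof.
move=> jk jQ; rewrite -(subnKC jk) addSnnS => /grid_ancestor[Q' jQ' [QQ' lt_m]].
have [l1 [l2 [_ [_ [_ [_ [_ [_ [_ [triv _]]]]]]]]]] := gP.
have : Q = Q'; last by move=> QE; rewrite -QE ltxx in lt_m.
apply: (triv j) => //=; rewrite (setIidl QQ').
apply/set0P/negP => /eqP Q0; have := grid_gt0 jQ.
by rewrite Q0 measure0 ltxx.
Qed.

(** Coefficients are indexed by sets and not by pairs of a level and a set: a set present at two
    levels would be counted twice in the cost and in the series. *)
Lemma grid_level_inj j k Q : P j Q -> P k Q -> j = k.
Proof.
move=> jQ kQ; case: (ltngtP j k) => // jk.
- by case: (grid_level_lt jk jQ).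
- by case: (grid_level_lt jk kQ).
Qed.

Let Pfin := grid_finite.
Let Pmeas := grid_measurable.

Definition unit_coef Q : set T -> R[i] := fun J => (J == Q)%:R.

Lemma weight_unit_coef k Q j : P k Q -> weight P (unit_coef Q) j = (j == k)%:R.
Proof.
move=> kQ; rewrite weightE//.
have [->|jk] := eqVneq j k.
  rewrite (big_fsetD1 Q)/=; last by rewrite in_fset_set// mem_set.
  rewrite /unit_coef eqxx Normc.normc1 big1_seq ?addr0// => J /andP[_].
  by rewrite !inE => /andP[/negbTE -> _]; rewrite cmod0.
rewrite big1_seq// => J /andP[_ /(fset_gridP Pfin) jJ].
rewrite /unit_coef; case: eqP => [JQ|_]; last by rewrite cmod0.
by rewrite JQ in jJ; rewrite (grid_level_inj jJ kQ) eqxx in jk.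
Qed.

Lemma canonical_level_unit_coef k Q j x : P k Q ->
  clevel (unit_coef Q) j x = (j == k)%:R * kap Q x.
Proof.
move=> kQ; rewrite canonical_levelE//.
have [->|jk] := eqVneq j k.
  rewrite (big_fsetD1 Q)/=; last by rewrite in_fset_set// mem_set.
  rewrite /unit_coef eqxx big1_seq ?addr0// => J /andP[_].
  by rewrite !inE => /andP[/negbTE -> _]; rewrite mul0r.
rewrite mul0r big1_seq// => J /andP[_ /(fset_gridP Pfin) jJ].
rewrite /unit_coef; case: eqP => [JQ|_]; last by rewrite mul0r.
by rewrite JQ in jJ; rewrite (grid_level_inj jJ kQ) eqxx in jk.
Qed.

Lemma rep_cost_unit_coef k Q : P k Q -> rep_cost P (unit_coef Q) = 1%E.
Proof.
move=> kQ; rewrite /rep_cost (nneseries_split _ k.+1); last first.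
  by move=> j _; rewrite lee_fin; exact: weight_ge0.
rewrite eseries0 ?adde0; last first.
  move=> j kj _; rewrite -/(weight _ _ _) (weight_unit_coef _ kQ).
  by rewrite gtn_eqF.
rewrite add0n big_nat_recr//= -/(weight _ _ _) (weight_unit_coef _ kQ) eqxx.
rewrite big_nat big1 ?add0e// => j /andP[_ jk].
by rewrite -/(weight _ _ _) (weight_unit_coef _ kQ) ltn_eqF.
Qed.

Lemma canonical_rep_unit_coef k Q : P k Q -> crep (kap Q) (unit_coef Q).
Proof.
move=> kQ; have mQ := Pmeas kQ; split.
- split; first exact: cmeasurable_canonical_atom.
  by apply: le_lt_trans (L1norm_canonical_atom m s0 mQ) _; rewrite ltry.
- by rewrite (rep_cost_unit_coef kQ) ltry.
(* Once n > k, the partial sum contains the only nonzero level and equals the canonical atom. *)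
apply: cvg_near_cst; near=> n; have kn : (k < n)%N by near: n; exact: nbhs_infty_gt.
rewrite -[RHS](L1norm0 m); congr (L1norm m _); apply/funext => x.
rewrite (bigD1 (Ordinal kn))//= (canonical_level_unit_coef _ _ kQ) eqxx mul1r.
rewrite big1 ?addr0 ?subrr// => j jk; rewrite (canonical_level_unit_coef _ _ kQ).
by rewrite (negbTE (_ : val j != k)) ?mul0r//.
Unshelve. all: by end_near. Qed.

(** The factor is the value of the atom times |Q|^(1-s). The bound on the atom is evaluated at a
    point of Q, which exists because |Q| > 0. *)
Lemma souza_atom_multiple k Q b : P k Q -> souza_atom m s Q b ->
  exists2 z : R[i], cmod z <= 1 & b = fun x => z * kap Q x.
Proof.
move=> kQ [[z bz] bout ble].
have Q0 := grid_fine_gt0 kQ.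
have [x Qx] : exists x, Q x.
  apply/set0P/negP => /eqP QE; have := grid_gt0 kQ.
  by rewrite QE measure0 ltxx.
exists (z * ((fine (m Q) `^ (1 - s))%:C)%C).
  have := ble x; rewrite (bz _ Qx) => zle.
  rewrite cmodM cmod_real ger0_norm ?powR_ge0//.
  apply: le_trans (ler_wpM2r (powR_ge0 _ _) zle) _.
  by rewrite mulrC powR_cancel.
apply/funext => y; have [Qy|Qy] := pselect (Q y); last first.
  by rewrite canonical_atom_out// bout// mulr0.
rewrite (bz _ Qy) /canonical_atom asboolT// -mulrA -rmorphM/= powR_cancel//.
by rewrite mulr1.
Qed.

Lemma besov_canonical g : besov m P s g -> exists c, crep g c.
Proof.
by move=> [c [a /(canonical_rep_of_besov_rep Pfin Pmeas (@grid_gt0))[e ? _]]]; exists e.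
Qed.

Lemma canonical_besov g c : crep g c -> besov m P s g.
Proof.
by move=> gc; exists c, kap; exact: besov_rep_canonical.
Qed.

Lemma besov_norm_ge0 g : (0 <= besov_norm m P s g)%E.
Proof.
by apply: le_ereal_inf_tmp => _ [c [a [_ ->]]]; exact: rep_cost_ge0.
Qed.

Lemma besov_norm_le g c : crep g c -> (besov_norm m P s g <= rep_cost P c)%E.
Proof.
move=> gc; apply: ereal_inf_lbound; exists c, kap; split => //.
exact: besov_rep_canonical.
Qed.

(** The infimum need not be attained, so a canonical representation is extracted only under a strict
    bound. *)
Lemma besov_norm_lt g (t : \bar R) : (besov_norm m P s g < t)%E ->
  exists2 c, crep g c & (rep_cost P c < t)%E.
Proof.
move=> /ereal_inf_lt[_ [c [a [ca ->]]] ct].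
have [e ge ec] := canonical_rep_of_besov_rep Pfin Pmeas (@grid_gt0) ca.
by exists e => //; exact: le_lt_trans ct.
Qed.

Lemma besov_atom k Q b : P k Q -> souza_atom m s Q b ->
  besov m P s b /\ (besov_norm m P s b <= 1)%E.
Proof.
move=> kQ /(souza_atom_multiple kQ)[z z1 ->].
have zc := canonical_repZ Pfin Pmeas z (canonical_rep_unit_coef kQ).
split; first exact: canonical_besov zc.
apply: le_trans (besov_norm_le zc) _.
by rewrite rep_costZ// (rep_cost_unit_coef kQ) mule1 lee_fin.
Qed.

(** The whole space is the element of level 0, and 1 is |I|^(1-s) times its canonical atom. *)
Lemma besov_cst1 : besov m P s (fun=> 1).
Proof.
have := canonical_repZ Pfin Pmeas ((fine (m setT) `^ (1 - s))%:C)%C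
  (canonical_rep_unit_coef grid0).
rewrite (_ : (fun x => _) = fun=> 1); first exact: canonical_besov.
apply/funext => x; rewrite /canonical_atom asboolT// -rmorphM/= powR_cancel//.
exact: grid_fine_gt0 grid0.
Qed.

Lemma multipliers_sub_selfs : multipliers m P s `<=` besov_selfs m P s.
Proof.
move=> g [mg [C gC]]; split.
  by have [+ _] := gC _ besov_cst1; under [X in besov _ _ _ X]eq_fun do rewrite mulr1.
(* The absolute value makes the bound monotone in the norm of the atom, as the sign of [C] is not
   prescribed. *)
apply: (@le_lt_trans _ _ `|C|%:E%E); last exact: ltry.
apply: ge_ereal_sup => _ [k [Q [b [kQ [bQ ->]]]]].
have [bb b1] := besov_atom kQ bQ.
have [_ gb] := gC _ bb; apply: le_trans gb _.
apply: (@le_trans _ _ (`|C|%:E * besov_norm m P s b)%E).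
  by rewrite lee_wpmul2r ?besov_norm_ge0// lee_fin ler_norm.
by rewrite -[leRHS]mule1 lee_wpmul2l// lee_fin.
Qed.

Lemma selfs_sub_multipliers : besov_selfs m P s `<=` multipliers m P s.
Proof.
move=> g [/besov_canonical[cg [[mg _] _ _]] supoo]; split => //.
set S := ereal_sup _ in supoo.
have normS k Q : P k Q -> (besov_norm m P s (fun x => (g x * kap Q x)%R) <= S)%E.
  move=> kQ; apply: ereal_sup_ubound; exists k, Q, (kap Q).
  by split => //; split => //; exact: souza_atom_canonical.
(* The supremum is over a nonempty family, the whole space being in the grid, so it cannot be
   [-oo]. *)
have S0 : (0 <= S)%E by apply: le_trans (normS _ _ grid0); exact: besov_norm_ge0.
have Sfin : S \is a fin_num by rewrite ge0_fin_numE.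
(* Adding 1 leaves room for representations that only approach the infimum, and makes [C] positive
   for the division below. *)
pose C := fine S + 1.
have C0 : 0 < C by rewrite ltr_wpDl ?fine_ge0.
have gkap k Q : P k Q -> exists2 e, crep (fun x => g x * kap Q x) e &
    (rep_cost P e <= C%:E)%E.
  move=> kQ; have : (besov_norm m P s (fun x => (g x * kap Q x)%R) < C%:E)%E.
    apply: le_lt_trans (normS _ _ kQ) _.
    by rewrite -(fineK Sfin) lte_fin ltrDl.
  by move=> /besov_norm_lt[e ge eC]; exists e => //; exact: ltW.
have gmul f c : crep f c -> exists2 e, crep (fun x => g x * f x) e &
    (rep_cost P e <= C%:E * rep_cost P c)%E.
  by apply: canonical_rep_mul => //; exact: ltW.
exists C => f bf; split.
  by have [c /gmul[e /canonical_besov]] := besov_canonical bf.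
(* After division by [C], it suffices to bound the left side by the cost of each representation of
   f, first replaced by a canonical one of no greater cost. *)
rewrite -lee_pdivrMl//; apply: le_ereal_inf_tmp => _ [c [a [ca ->]]].
have [e fe ec] := canonical_rep_of_besov_rep Pfin Pmeas (@grid_gt0) ca.
apply: le_trans ec; rewrite lee_pdivrMl//.
have [e' ge' e'e] := gmul _ _ fe.
exact: le_trans (besov_norm_le ge') e'e.
Qed.

End grid.

Theorem proposition18p1 (d : measure_display) (T : measurableType d)
    (R : realType) (m : {finite_measure set T -> \bar R})
    (P : nat -> set (set T)) (s : R) :
  good_grid m P -> 0 < s -> s < 1 ->
  multipliers m P s = besov_selfs m P s.
Proof.
move=> gP s0 _; apply/seteqP; split.
- exact: multipliers_sub_selfs.
- exact: selfs_sub_multipliers.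
Qed.
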